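(* Suppose $L\in(0,\infty)\setminus E$ and $|\delta|<\delta_1$. Then $u=0$ is an isolated solution of $$0=\delta uu_x+\Delta^3u-\Delta^2W'(u)$$ in $\dot H^6_{per}$.
   Context: $\mathbb{T}=\mathbb{R}/L\mathbb{Z}$, $\Delta=\partial_x^2$, $W(v)=\frac14(v^2-1)^2$; $\dot H^k_{per}$ is the space of zero-mean functions in $H^k(\mathbb{T})$. Isolated means that some neighbourhood of $0$ in $\dot H^6_{per}$ contains no other solution. $E$: for $c=(c_1,c_2)$ let $P_c(u)=2(W(u)+c_1u+c_2)$; let $\mathcal{C}$ be the set of $(c_1,c_2)$ with $c_2\in(-\frac14,0)$ for which $P_c$ has four distinct real roots $u_1<u_m<0<u_M<u_2$; let $g_1(c)=\int_{u_m}^{u_M}\frac{du}{\sqrt{P_c(u)}}$ on $\mathcal{C}$, and $E=Z\cup\{2k\pi:k\ge1\}$ with $Z$ the (Lebesgue null) set of critical values of $g_1$. $\delta_1>0$: the nonconstant zero-mean $L$-periodic solutions of $\Delta^2(\Delta u-W'(u))=0$ form finitely many (possibly no) translation orbits, with representatives $u^1,\dots,u^n$ vanishing at $0$; these continue to $C^1$ branches $\delta\mapsto u^{\delta,i}\in\dot H^6_{per}$, $u^{\delta,i}(0)=0$, $u^{0,i}=u^i$, of solutions of $\delta uu_x+\Delta^2(\Delta u-W'(u))=0$ for $|\delta|<\delta_0$. The number $\delta_1\in(0,\delta_0]$ is such that for $|\delta|<\delta_1$ the kernel in $\dot H^6_{per}$ of $h\mapsto\delta(u^*h)_x+\Delta^2(\Delta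 h-W''(u^* )h)$ is one-dimensional for $u^*=u^{\delta,i}$, $i=1,\dots,n$, and trivial for $u^*=0$. *)

(* Defs.v *)
From HB Require Import structures.
From mathcomp Require Import all_boot all_order all_algebra.
From mathcomp Require Import all_classical all_reals all_analysis.

Set Implicit Arguments.
Unset Strict Implicit.
Unset Printing Implicit Defensive.
Import Order.TTheory GRing.Theory Num.Theory.
Import numFieldNormedType.Exports.

Local Open Scope classical_set_scope.
Local Open Scope ring_scope.

(* Functions on the circle R/LZ are represented by L-periodic functions on R,
   and integrals over the circle by integrals over [0, L]. *)
Section Sobolev.
Context {R : realType}.
Variable L : R.
Local Notation mu := (@lebesgue_measure R).
Implicit Types (u v phi : R -> R) (k : nat).

Definition test_function phi :=
  periodic phi L /\ forall k x, derivable (derive1n k phi) x 1.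

Definition L2per v :=
  [/\ periodic v L, measurable_fun [set: R] v
    & mu.-integrable `[0, L] (fun x => (v x ^+ 2)%:E)].

Definition L2norm v : R := Num.sqrt (\int[mu]_(x in `[0, L]) (v x ^+ 2)).

Definition weak_derivative k u v :=
  L2per v /\ forall phi, test_function phi ->
    \int[mu]_(x in `[0, L]) (u x * derive1n k phi x) =
    (-1) ^+ k * \int[mu]_(x in `[0, L]) (v x * phi x).

(* A representative of the k-th weak derivative in L^2 of the circle, which is
   unique up to a null set; the default value 0 is only taken by functions that
   have no such derivative. *)
Definition wD k u : R -> R := xget (cst 0) [set v | weak_derivative k u v].

(* H^k of the circle.  For k >= 1 every class has exactly one continuous
   representative; requiring continuity selects it, so that pointwise values
   such as u 0 and equality of elements have their usual meaning.  This
   definition is meant for k >= 1 only. *)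
Definition Hper k : set (R -> R) :=
  [set u | [/\ continuous u, periodic u L
    & forall j, (j <= k)%N -> exists v, weak_derivative j u v]].

Definition Hdot k : set (R -> R) :=
  [set u | Hper k u /\ \int[mu]_(x in `[0, L]) u x = 0].

Definition Hnorm k u : R := Num.sqrt (\sum_(j < k.+1) L2norm (wD j u) ^+ 2).

Definition vanishes_ae v := {ae mu, forall x, x \in `[0, L] -> v x = 0}.

(* delta |-> u delta is of class C^1 from ]-d0, d0[ to Hdot k *)
Definition C1_curve k (d0 : R) (u : R -> R -> R) :=
  exists u' : R -> R -> R, forall d, `|d| < d0 ->
    [/\ Hdot k (u d), Hdot k (u' d),
        Hnorm k (fun x => h^-1 * (u (d + h) x - u d x) - u' d x)
          @[h --> 0^'] --> (0 : R)
      & Hnorm k (fun x => u' e x - u' d x) @[e --> d] --> (0 : R)].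

End Sobolev.

Section Equation.
Context {R : realType}.

Definition W (v : R) : R := (v ^+ 2 - 1) ^+ 2 / 4.

Variables (L delta : R).
Local Notation Delta := (wD L 2).
Local Notation Delta2 := (wD L 4).
Local Notation Delta3 := (wD L 6).
Implicit Types u h : R -> R.

Definition solution u :=
  Hdot L 6 u /\
  vanishes_ae L (fun x =>
    delta * (u x * wD L 1 u x) + Delta3 u x
    - Delta2 (fun y => derive1 W (u y)) x).

Definition lin_kernel u : set (R -> R) :=
  [set h | Hdot L 6 h /\
    vanishes_ae L (fun x =>
      delta * wD L 1 (fun y => u y * h y) x
      + Delta2 (fun y => Delta h y - derive1n 2 W (u y) * h y) x)].

Definition trivial_kernel u := forall h, lin_kernel u h -> h = cst 0.

Definition one_dimensional_kernel u :=
  exists h0, [/\ lin_kernel u h0, h0 <> cst 0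
    & forall h, lin_kernel u h -> exists a : R, h = (fun x => a * h0 x)].

Definition isolated_solution u :=
  solution u /\ exists2 eps : R, 0 < eps &
    forall v, solution v -> Hnorm L 6 (fun x => v x - u x) < eps -> v = u.

End Equation.

Section ExceptionalSet.
Context {R : realType}.
Local Notation mu := (@lebesgue_measure R).
Implicit Types c : R * R.

Definition Pc c (u : R) : R := 2 * (W u + c.1 * u + c.2).

Definition ordered_roots c (u1 um uM u2 : R) :=
  [/\ [/\ u1 < um, um < 0, 0 < uM & uM < u2]
    & [/\ Pc c u1 = 0, Pc c um = 0, Pc c uM = 0 & Pc c u2 = 0]].

Definition calC : set (R * R) :=
  [set c | - 4^-1 < c.2 < 0 /\ exists u1 um uM u2, ordered_roots c u1 um uM u2].

(* the pair (u_m, u_M), unique for c in calC since Pc c is a quartic *)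
Definition inner_roots c : R * R :=
  xget (0, 0) [set r | exists u1 u2, ordered_roots c u1 r.1 r.2 u2].

(* calC is open, so differentiability of g1 at a point of calC does not depend
   on the values of g1 outside calC. *)
Definition g1 c : R :=
  let r := inner_roots c in
  \int[mu]_(u in `]r.1, r.2[) (Num.sqrt (Pc c u))^-1.

Definition critical_values : set R :=
  [set g1 c | c in [set c | calC c /\ is_diff c g1 (cst 0)]].

Definition excE : set R :=
  critical_values `|` [set 2 * k%:R * pi | k in [set k : nat | (1 <= k)%N]].

End ExceptionalSet.

Section Branches.
Context {R : realType}.
Variables (L : R) (n : nat).
Local Notation translate u s := (fun x : R => u (x + s)).

Definition orbit_representatives (u : 'I_n -> R -> R) :=
  [/\ forall i, [/\ solution L 0 (u i), ~ (exists a, u i = cst a) & u i 0 = 0],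
      forall v, solution L 0 v -> ~ (exists a, v = cst a) ->
        exists i s, v = translate (u i) s
    & forall i j s, u i = translate (u j) s -> i = j].

Definition solution_branches (u : 'I_n -> R -> R) (d0 : R)
    (ub : 'I_n -> R -> R -> R) :=
  forall i, [/\ C1_curve L 6 d0 (ub i), ub i 0 = u i
    & forall d, `|d| < d0 -> solution L d (ub i d) /\ ub i d 0 = 0].

Definition kernel_condition (d1 : R) (ub : 'I_n -> R -> R -> R) :=
  forall d, `|d| < d1 ->
    (forall i, one_dimensional_kernel L d (ub i d)) /\
    trivial_kernel L d (cst 0).

End Branches.

(* Main.v *)
(* Testing the equation for a solution [v] against the waves
   [cos (k omega x + b)], omega = 2 pi / L, multiplies the k-th Fourier
   coefficient by [(k omega)^4 ((k omega)^2 - 1)] on the linear side. As L is not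
   a multiple of 2 pi, the last factor is at least [c k^2], while the nonlinear
   terms are at most a small constant times [s (k omega)^4], where [s = max |v|].
   So the coefficients are bounded by [small * s / k^2], which is summable, and
   Fejer's kernel turns this into [s <= s / 2], hence [v = 0]. That [s] itself is
   small follows in the same way from the L^2 bound on the second derivative.

   That 0 is a solution amounts to its weak derivatives vanishing almost
   everywhere: a function orthogonal to all test functions has vanishing
   integral over every [[0, t]], since indicator functions of intervals are
   bounded pointwise limits of trigonometric polynomials. *)
Require Import Defs.
From mathcomp Require Import all_boot all_order all_algebra.
From mathcomp Require Import all_classical all_reals all_analysis.
From mathcomp Require Import measurable_realfun ring lra.
Import Order.TTheory GRing.Theory Num.Theory.
Import numFieldNormedType.Exports.
Local Open Scope classical_set_scope.
Local Open Scope ring_scope.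
Set Implicit Arguments.
Unset Strict Implicit.
Unset Printing Implicit Defensive.

(** * Differentiability to finite order and derivatives of waves *)

Section Smooth.
Context {R : realType}.
Implicit Types (f g : R -> R) (a b c x : R) (k n : nat).

(** Counting the order allows induction for products: in [f * g' + g * f'] each factor is
    differentiable to one order less, the undifferentiated one by weakening. *)
Definition derivable_upto k f :=
  forall i x, (i <= k)%N -> derivable (derive1n i f) x 1.

Lemma derivable_uptoS k f : derivable_upto k.+1 f <->
  (forall x, derivable f x 1) /\ derivable_upto k (derive1 f).
Proof.
split=> [df|[df df'] [//|i] x ik]; last by rewrite derive1Sn; exact: df'.
by split=> [x|i x ik]; [exact: (df 0%N)|rewrite -derive1Sn; exact: df].
Qed.

Lemma derivable_uptoW k f : derivable_upto k.+1 f -> derivable_upto k f.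
Proof. by move=> df i x ik; apply: df; exact: leqW. Qed.

Lemma derivable_uptoD k f g :
  derivable_upto k f -> derivable_upto k g -> derivable_upto k (f \+ g).
Proof.
elim: k f g => [|k IH] f g df dg.
  by case=> // x _; apply: derivableD; [exact: (df 0%N)|exact: (dg 0%N)].
have [/derivable_uptoS[df0 df'] /derivable_uptoS[dg0 dg']] := (df, dg).
apply/derivable_uptoS; split=> [x|]; first exact: derivableD.
have -> : derive1 (f \+ g) = derive1 f \+ derive1 g.
  by apply/funext => y; rewrite derive1E deriveD//= -!derive1E.
exact: IH.
Qed.

Lemma derivable_uptoM k f g :
  derivable_upto k f -> derivable_upto k g -> derivable_upto k (f \* g).
Proof.
elim: k f g => [|k IH] f g df dg.
  by case=> // x _; apply: derivableM; [exact: (df 0%N)|exact: (dg 0%N)].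
have [/derivable_uptoS[df0 df'] /derivable_uptoS[dg0 dg']] := (df, dg).
apply/derivable_uptoS; split=> [x|]; first exact: derivableM.
have -> : derive1 (f \* g) = (f \* derive1 g) \+ (g \* derive1 f).
  by apply/funext => y; rewrite derive1E deriveM// -!derive1E.
by apply: derivable_uptoD; apply: IH => //; exact: derivable_uptoW.
Qed.

(** Differentiation advances the phase by a quarter turn. With a free phase [b] the waves are thus
    stable under differentiation, and sines need no separate treatment. *)
Lemma derive1_wave a b c :
  derive1 (fun x => c * cos (a * x + b)) =
  (fun x => (c * a) * cos (a * x + (b + pi / 2))).
Proof.
apply/funext => x; rewrite derive1E; apply: derive_val.
apply: is_derive_eq => /=.
rewrite addrA cosDpihalf /GRing.scale/=; ring.
Qed.

Lemma derivable_wave a b c x : derivable (fun x => c * cos (a * x + b)) x 1.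
Proof. by apply: ex_derive. Qed.

Lemma derive1n_wave a b k :
  derive1n k (fun x => cos (a * x + b)) =
  (fun x => a ^+ k * cos (a * x + (b + (pi / 2) *+ k))).
Proof.
elim: k => [|k IH]; first by apply/funext => x; rewrite mul1r mulr0n addr0.
rewrite derive1nS IH derive1_wave -exprSr; apply/funext => x.
by rewrite -addrA -mulrSr.
Qed.

Lemma derivable_upto_cst c k : derivable_upto k (cst c).
Proof.
elim: k c => [|k IH] c; first by case=> // x _; exact: derivable_cst.
apply/derivable_uptoS; split=> [x|]; first exact: derivable_cst.
have -> : derive1 (cst c : R -> R) = cst 0.
  by apply/funext => x; rewrite derive1_cst.
exact: IH.
Qed.

End Smooth.

(** * Closure properties of test functions *)

Section TestFunctions.
Context {R : realType} (L : R).
Hypothesis L_gt0 : 0 < L.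
Implicit Types (phi psi : R -> R) (a b c x : R) (k n : nat).

Lemma test_functionP phi :
  test_function L phi <-> periodic phi L /\ forall k, derivable_upto k phi.
Proof.
split=> -[pphi dphi]; split=> // k; first by move=> i x _.
by move=> x; exact: (dphi k k).
Qed.

Lemma test_cst c : test_function L (cst c).
Proof. by apply/test_functionP; split=> // k; exact: derivable_upto_cst. Qed.

Lemma testD phi psi : test_function L phi -> test_function L psi ->
  test_function L (phi \+ psi).
Proof.
move=> /test_functionP[pf df] /test_functionP[pg dg].
apply/test_functionP; split=> [x|k]; first by rewrite /= pf pg.
exact: derivable_uptoD.
Qed.

Lemma testM phi psi : test_function L phi -> test_function L psi ->
  test_function L (phi \* psi).
Proof.
move=> /test_functionP[pf df] /test_functionP[pg dg].
apply/test_functionP; split=> [x|k]; first by rewrite /= pf pg.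
exact: derivable_uptoM.
Qed.

Lemma testX phi n : test_function L phi -> test_function L (fun x => phi x ^+ n).
Proof.
move=> tphi; elim: n => [|n IH]; first exact: test_cst.
have -> : (fun x => phi x ^+ n.+1) = phi \* (fun x => phi x ^+ n).
  by apply/funext => x; rewrite exprS.
exact: testM.
Qed.

Definition omega : R := 2 * pi / L.

Lemma omega_gt0 : 0 < omega.
Proof. by rewrite /omega divr_gt0// mulr_gt0// pi_gt0. Qed.

Lemma omegaL : omega * L = 2 * pi.
Proof. by rewrite /omega divfK// gt_eqF. Qed.

Lemma cos_add_2pin x k : cos (x + (2 * pi) *+ k) = cos x.
Proof.
have -> : 2 * pi = pi *+ 2 :> R by rewrite mulr_natl.
elim: k x => [|k IH] x; first by rewrite mulr0n addr0.
by rewrite mulrSr addrA cosD2pi.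
Qed.

Lemma test_wave k b : test_function L (fun x => cos (k%:R * omega * x + b)).
Proof.
split=> [x|i x]; last by rewrite derive1n_wave; exact: derivable_wave.
rewrite -(cos_add_2pin (k%:R * omega * x + b) k); congr cos.
by rewrite -omegaL -mulr_natl; ring.
Qed.

Lemma test_continuous phi : test_function L phi -> continuous phi.
Proof.
move=> [_ dphi] x; apply: differentiable_continuous.
by apply/derivable1_diffP; exact: (dphi 0%N).
Qed.

End TestFunctions.

(** * Fejer's kernel *)

Section CircleIntegral.
Context {R : realType} (L : R).
Hypothesis L_gt0 : 0 < L.
Local Notation mu := (@lebesgue_measure R).
Local Notation intL f := (\int[mu]_(x in `[0, L]) f x).
Local Notation integrableL f := (mu.-integrable `[0, L] (EFin \o f)).
Implicit Types (f g : R -> R) (a b c B x : R).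

Let mI : measurable (`[0, L]%classic : set R). Proof. exact: measurable_itv. Qed.

Lemma continuous_integrableL f : continuous f -> integrableL f.
Proof.
move=> cf; apply: continuous_compact_integrable; first exact: segment_compact.
exact: continuous_subspaceT.
Qed.

Lemma integrableL_mulb f g B : integrableL f -> measurable_fun setT g ->
  (forall x, x \in `[0, L] -> `|g x| <= B) -> integrableL (f \* g).
Proof.
move=> fi mg gB.
have -> : EFin \o (f \* g) = ((EFin \o f) \* (EFin \o g))%E by [].
apply: integrableMl => //; first exact: measurable_funTS.
exists B; split; first exact: num_real.
by move=> M BM x xI; exact: le_trans (gB _ xI) (ltW BM).
Qed.

Lemma integrableL_mulc f g : integrableL f -> continuous g ->
  integrableL (f \* g).
Proof.
move=> fi cg; have cgn : continuous (fun x => `|g x|).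
  by move=> x; apply: continuous_comp; [exact: cg|exact: norm_continuous].
have [||c _ cmax] := @EVT_max R (fun x => `|g x|) 0 L; first exact: ltW.
  exact: continuous_subspaceT.
apply: (@integrableL_mulb _ _ `|g c|) => //.
exact: continuous_measurable_fun.
Qed.

Lemma intL_cst c : intL (cst c) = c * L.
Proof.
rewrite Rintegral_cst//= lebesgue_measure_itv/= lte_fin L_gt0.
by rewrite oppr0 addr0.
Qed.

Lemma norm_intL_le f g : integrableL f -> integrableL g ->
  (forall x, x \in `[0, L] -> `|f x| <= g x) -> `|intL f| <= intL g.
Proof.
move=> fi gi fg; apply: (le_trans (le_normr_Rintegral _ _)) => //.
apply: le_Rintegral => //.
have -> : EFin \o (fun x => `|f x|) = (fun x => `|(EFin \o f) x|%E) by [].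
exact: integrable_abse.
Qed.

Lemma wave_continuous a b c : continuous (fun x => c * cos (a * x + b)).
Proof.
move=> x; apply: differentiable_continuous; apply/derivable1_diffP.
exact: derivable_wave.
Qed.

Lemma intL_wave k b : (0 < k)%N ->
  intL (fun x => cos (k%:R * omega L * x + b)) = 0.
Proof.
move=> k0; set a := k%:R * omega L.
have a0 : a != 0 by rewrite gt_eqF// mulr_gt0 ?ltr0n ?omega_gt0.
(* A primitive: the phase is set back by the quarter turn that differentiation adds. Its values at 0
   and [L] agree because [a * L] is a multiple of 2 pi. *)
pose F x := a^-1 * cos (a * x + (b - pi / 2)).
have F'E : derive1 F = (fun x => cos (a * x + b)).
  by rewrite derive1_wave mulVf//; apply/funext => x; rewrite mul1r subrK.
have cF : continuous F by exact: wave_continuous.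
rewrite /Rintegral (@continuous_FTC2 _ _ F)//=.
- rewrite /F mulr0 add0r /a -mulrA omegaL// [k%:R * (2 * pi)]mulr_natl.
  by rewrite [_ + (b - _)]addrC cos_add_2pin subrr.
- apply: continuous_subspaceT.
  have := @wave_continuous a b 1.
  by under eq_fun do rewrite mul1r.
- split=> [x _||]; first exact: derivable_wave.
  + by apply: cvg_at_right_filter; exact: cF.
  + by apply: cvg_at_left_filter; exact: cF.
- by move=> x _; rewrite F'E.
Qed.

End CircleIntegral.

(** * Dirichlet and Fejer kernels *)

Section Fejer.
Context {R : realType}.
Implicit Types (t : R) (n k : nat).

Definition dirichlet n t : R := 1 + \sum_(k < n) 2 * cos (k.+1%:R * t).

(** Not divided by [n]: this is [n] times the usual Fejer kernel, with mean value [n] over a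
    period. *)
Definition fejer n t : R := \sum_(i < n) dirichlet i t.

Lemma dirichletS n t :
  dirichlet n.+1 t = dirichlet n t + 2 * cos (n.+1%:R * t).
Proof. by rewrite /dirichlet big_ord_recr/= addrA. Qed.

Lemma fejerS n t : fejer n.+1 t = fejer n t + dirichlet n t.
Proof. by rewrite /fejer big_ord_recr. Qed.

(** The product formula for cosines makes the sum telescope. Multiplying by [1 - cos t] keeps the
    closed form valid at multiples of 2 pi, where a quotient would fail. *)
Lemma dirichletE n t : (1 - cos t) * dirichlet n t =
  cos (n%:R * t) - cos (n.+1%:R * t).
Proof.
elim: n => [|n IH].
  by rewrite /dirichlet big_ord0 mul0r cos0 mul1r addr0 mulr1.
rewrite dirichletS mulrDr IH.
have -> : n.+2%:R * t = n.+1%:R * t + t by rewrite -[n.+2%:R]natr1; ring.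
have -> : n%:R * t = n.+1%:R * t - t by rewrite -[n.+1%:R]natr1; ring.
rewrite cosB cosD; ring.
Qed.

Lemma fejerE n t : (1 - cos t) * fejer n t = 1 - cos (n%:R * t).
Proof.
elim: n => [|n IH]; first by rewrite /fejer big_ord0 mulr0 mul0r cos0 subrr.
by rewrite fejerS mulrDr IH dirichletE; ring.
Qed.

Lemma fejer_ge0 n t : 0 <= fejer n t.
Proof.
have [cost1|cost1] := eqVneq (cos t) 1.
  (* Here [fejerE] reads 0 = 0 and says nothing; instead every cosine in the sum equals 1. In the
     other case one divides by [1 - cos t]. *)
  have sint0 : sin t = 0 by apply: cos1sin0; rewrite cost1 normr1.
  apply: sumr_ge0 => i _; apply: addr_ge0 => //; apply: sumr_ge0 => k _.
  have -> : cos (k.+1%:R * t) = 1 :> R; last by rewrite mulr1.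
  elim: {k}k.+1 => [|m IH]; first by rewrite mul0r cos0.
  by rewrite -natr1 mulrDl mul1r cosD IH sint0 cost1 mulr0 subr0 mulr1.
have cost_lt1 : 0 < 1 - cos t by rewrite subr_gt0 lt_neqAle cost1 cos_le1.
by rewrite -(pmulr_rge0 _ cost_lt1) fejerE subr_ge0 cos_le1.
Qed.

Lemma dirichlet_continuous n : continuous (dirichlet n).
Proof.
elim: n => [|n IH] t.
  rewrite (_ : dirichlet 0 = cst 1); first exact: cvg_cst.
  by apply/funext => s; rewrite /dirichlet big_ord0 addr0.
rewrite (_ : dirichlet n.+1 =
    dirichlet n \+ (fun s => 2 * cos (n.+1%:R * s + 0))).
  by apply: cvgD; [exact: IH|exact: wave_continuous].
by apply/funext => s; rewrite dirichletS /= addr0.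
Qed.

Lemma fejer_continuous n : continuous (fejer n).
Proof.
elim: n => [|n IH] t.
  rewrite (_ : fejer 0 = cst 0); first exact: cvg_cst.
  by apply/funext => s; rewrite /fejer big_ord0.
rewrite (_ : fejer n.+1 = fejer n \+ dirichlet n).
  by apply: cvgD; [exact: IH|exact: dirichlet_continuous].
by apply/funext => s; rewrite fejerS.
Qed.

End Fejer.

(** * From decay of Fourier moments to a uniform bound *)

Section FejerBound.
Context {R : realType} (L : R).
Hypothesis L_gt0 : 0 < L.
Local Notation mu := (@lebesgue_measure R).
Local Notation intL f := (\int[mu]_(x in `[0, L]) f x).
Local Notation integrableL f := (mu.-integrable `[0, L] (EFin \o f)).
Implicit Types (v f g : R -> R) (a b c x : R).

Let mI : measurable (`[0, L]%classic : set R). Proof. exact: measurable_itv. Qed.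

Lemma cos_lt1 t : 0 < `|t| < 2 * pi -> cos t < 1 :> R.
Proof.
move=> /andP[t0 t2pi].
have -> : cos t = cos `|t| by case: (ger0P t) => // _; rewrite cosN.
have s0 : 0 < sin (`|t| / 2).
  by apply: sin_gt0_pi; rewrite divr_gt0//= ltr_pdivrMr// mulrC.
have -> : `|t| = (`|t| / 2) *+ 2 by rewrite -mulr_natr divfK.
rewrite cos_mulr2n; have := cos2Dsin2 (`|t| / 2); nra.
Qed.

Local Notation theta c x := (omega L * (x - c)).

Lemma thetaE k c x : k%:R * theta c x = k%:R * omega L * x + - (k%:R * omega L * c).
Proof. ring. Qed.

Lemma theta_continuous (f : R -> R) c : continuous f ->
  continuous (fun x => f (theta c x)).
Proof.
move=> cf x; apply: (@continuous_comp _ _ _ (fun x => theta c x) f); last exact: cf.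
apply: cvgM; first exact: cvg_cst.
by apply: cvgB; [exact: cvg_id|exact: cvg_cst].
Qed.

Lemma mul_continuous f g : continuous f -> continuous g -> continuous (f \* g).
Proof. by move=> cf cg x; apply: cvgM; [exact: cf|exact: cg]. Qed.

Section Moments.
Variable v : R -> R.
Hypothesis cv : continuous v.

Lemma intL_dirichletS n c :
  intL (fun x => v x * dirichlet n.+1 (theta c x)) =
  intL (fun x => v x * dirichlet n (theta c x)) +
  2 * intL (fun x => v x *
       cos (n.+1%:R * omega L * x + - (n.+1%:R * omega L * c))).
Proof.
have cwave : continuous
    (fun x => cos (n.+1%:R * omega L * x + - (n.+1%:R * omega L * c))).
  by apply: (@test_continuous _ L); exact: test_wave.
rewrite -RintegralZl//; last first.
  by apply: continuous_integrableL; exact: mul_continuous.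
rewrite -RintegralD//.
- by apply: eq_Rintegral => x _; rewrite dirichletS thetaE; ring.
- apply: continuous_integrableL; apply: mul_continuous => //.
  exact/theta_continuous/dirichlet_continuous.
- apply: continuous_integrableL; apply: mul_continuous.
    by move=> x; exact: cvg_cst.
  exact: mul_continuous.
Qed.

Lemma intL_fejerS n c :
  intL (fun x => v x * fejer n.+1 (theta c x)) =
  intL (fun x => v x * fejer n (theta c x)) +
  intL (fun x => v x * dirichlet n (theta c x)).
Proof.
rewrite -RintegralD//.
- by apply: eq_Rintegral => x _; rewrite fejerS mulrDr.
- apply: continuous_integrableL; apply: mul_continuous => //.
  exact/theta_continuous/fejer_continuous.
- apply: continuous_integrableL; apply: mul_continuous => //.
  exact/theta_continuous/dirichlet_continuous.
Qed.

Lemma intL_dirichlet0 c :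
  intL (fun x => v x * dirichlet 0 (theta c x)) = intL v.
Proof.
by apply: eq_Rintegral => x _; rewrite /dirichlet big_ord0 addr0 mulr1.
Qed.

Lemma intL_fejer0 c : intL (fun x => v x * fejer 0 (theta c x)) = 0.
Proof.
rewrite (@eq_Rintegral _ _ _ _ _ (cst 0)); first by rewrite intL_cst// mul0r.
by move=> x _; rewrite /fejer big_ord0 mulr0.
Qed.

Variable M : R.
Hypothesis mean0 : intL v = 0.
Hypothesis vM : forall k b, (0 < k)%N ->
  `|intL (fun x => v x * cos (k%:R * omega L * x + b))| <= M / k%:R ^+ 2.

Lemma moment_bound_ge0 : 0 <= M.
Proof. by have := le_trans (normr_ge0 _) (@vM 1 0 isT); rewrite expr1n divr1. Qed.

(* [1/(n+1)^2 <= 2/(n+1) - 2/(n+2)], so the bounds on the moments telescope *)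
Lemma intL_dirichlet_le n c :
  `|intL (fun x => v x * dirichlet n (theta c x))| <= 4 * M * (1 - n.+1%:R^-1).
Proof.
have M0 := moment_bound_ge0.
elim: n => [|n IH].
  by rewrite intL_dirichlet0 mean0 normr0 invr1 subrr mulr0.
rewrite intL_dirichletS; apply: (le_trans (ler_normD _ _)).
rewrite normrM (ger0_norm (ler0n _ 2)).
apply: (le_trans (lerD IH (ler_wpM2l (ler0n _ 2) (@vM n.+1 _ isT)))).
set m : R := n.+1%:R; have m1 : 1 <= m by rewrite ler1n.
have -> : n.+2%:R = m + 1 :> R by rewrite natr1.
have -> : 2 * (M / m ^+ 2) = 4 * M * (2^-1 * m^-1 ^+ 2).
  by rewrite exprVn; field; rewrite gt_eqF//; lra.
rewrite -mulrDr; apply: ler_wpM2l; first by rewrite mulr_ge0.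
have -> : (m + 1)^-1 = m^-1 - m^-1 / (m + 1).
  by field; apply/andP; split; rewrite gt_eqF//; lra.
suff : 2^-1 * m^-1 ^+ 2 <= m^-1 / (m + 1).
  by move: m^-1 (2^-1 * _) (m^-1 / _) => z p q pq; lra.
rewrite expr2 mulrCA; apply: ler_wpM2l; first by rewrite invr_ge0; lra.
by rewrite -invfM lef_pV2 ?posrE; lra.
Qed.

Lemma intL_fejer_le n c :
  `|intL (fun x => v x * fejer n (theta c x))| <= 4 * M * n%:R.
Proof.
have M0 := moment_bound_ge0.
elim: n => [|n IH]; first by rewrite intL_fejer0 normr0 mulr0.
rewrite intL_fejerS; apply: (le_trans (ler_normD _ _)).
rewrite -[n.+1%:R]natr1 mulrDr; apply: lerD => //.
apply: (le_trans (intL_dirichlet_le _ _)); apply: ler_wpM2l.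
  by rewrite mulr_ge0.
by rewrite gerBl.
Qed.

End Moments.

Lemma intL_fejer n c : intL (fun x => fejer n (theta c x)) = n%:R * L.
Proof.
have c1 : continuous (cst 1 : R -> R) by move=> x; exact: cvg_cst.
(* The moment recursions are reused with [v] the constant 1: only the constant term of each
   Dirichlet kernel survives integration. *)
have D m : intL (fun x => cst 1 x * dirichlet m (theta c x)) = L.
  elim: m => [|m IH]; first by rewrite intL_dirichlet0 intL_cst// mul1r.
  rewrite intL_dirichletS// IH.
  under eq_Rintegral do rewrite mul1r.
  by rewrite intL_wave// mulr0 addr0.
suff : intL (fun x => cst 1 x * fejer n (theta c x)) = n%:R * L.
  by under eq_Rintegral do rewrite mul1r.
elim: n => [|n IH]; first by rewrite intL_fejer0 mul0r.
by rewrite intL_fejerS// IH D -natr1 mulrDl mul1r.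
Qed.

(** The points with [|v c - v x| >= e] form a compact set that misses [c] on the circle. So
    [1 - cos] has a positive minimum there, and [K] is the maximum of [|v c - v x|] divided by
    it. *)
Lemma continuity_modulus v c e : continuous v -> periodic v L -> c \in `[0, L] ->
  0 < e -> exists2 K, 0 <= K & forall x, x \in `[0, L] ->
    `|v c - v x| <= e + K * (1 - cos (theta c x)).
Proof.
move=> cv pv cI e0.
pose D := fun x => `|v c - v x|.
have cD : continuous D.
  move=> x; apply: cvg_norm.
  by apply: cvgB; [exact: cvg_cst|exact: cv].
pose q := fun x => 1 - cos (theta c x).
have cq : continuous q.
  move=> x; apply: cvgB; first exact: cvg_cst.
  exact: (@theta_continuous _ c (@continuous_cos R)).
have q0 x : 0 <= q x by rewrite subr_ge0 cos_le1.
pose A := `[0, L]%classic `&` [set x | e <= D x].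
have [A0|/forallNP A0] := pselect (A !=set0); last first.
  exists 0 => // x xI; rewrite mul0r addr0 leNgt; apply/negP => Dx.
  by apply: (A0 x); split => //; exact: ltW.
have clA : closed [set x | e <= D x].
  apply: (@preimage_closed _ _ D [set y | e <= y]); last exact: closed_ge.
  by move=> x _; exact: cD.
have cA : compact A by apply: compact_closedI => //; exact: segment_compact.
have [m mA mmin] := @compact_EVT_min _ R q A A0 cA (continuous_subspaceT cq).
have [d _ dmax] :=
  @EVT_max R D 0 L (ltW L_gt0) (continuous_subspaceT cD).
have qm : 0 < q m.
  move: mA; rewrite inE => -[/= mI' eDm].
  have vE : v L = v 0 by rewrite -[in LHS](add0r L) pv.
  move: cI mI'; rewrite !in_itv/= => /andP[c0 cL] /andP[m0 mL].
  rewrite /q subr_gt0; apply: cos_lt1; rewrite normrM (gtr0_norm (omega_gt0 L_gt0)).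
  rewrite -(omegaL L_gt0) pmulr_rgt0 ?ltr_pM2l ?omega_gt0// normr_gt0 subr_eq0.
  have Dm : `|v c - v m| != 0 by rewrite gt_eqF// (lt_le_trans e0).
  apply/andP; split.
    by apply: contra_neq Dm => ->; rewrite subrr normr0.
  have : `|m - c| <= L by rewrite ler_norml; apply/andP; split; lra.
  rewrite le_eqVlt => /predU1P[mcL|//].
  (* At distance [L] the points [c] and [m] are the two ends of the interval, hence the same point
     of the circle. *)
  exfalso; move/eqP: Dm; apply.
  have [h|h] := lerP 0 (m - c); move: mcL.
    rewrite ger0_norm// => mc; have -> : m = L by lra.
    have -> : c = 0 by lra.
    by rewrite vE subrr normr0.
  rewrite ltr0_norm// => mc; have -> : m = 0 by lra.
  have -> : c = L by lra.
  by rewrite vE subrr normr0.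
have K0 : 0 <= D d / q m by exact: divr_ge0 (normr_ge0 _) (ltW qm).
exists (D d / q m) => // x xI.
have [xA|xA] := leP e (D x); last first.
  by rewrite (le_trans (ltW xA))// lerDl mulr_ge0.
apply: (@le_trans _ _ (D d)); first exact: dmax.
rewrite -[leLHS](divfK (lt0r_neq0 qm)) -[leLHS]add0r lerD ?(ltW e0)//.
by apply: ler_wpM2l => //; apply: mmin; rewrite inE.
Qed.

(* Compare [v c] with the Fejer mean of [v] at [c]: the kernel times
   [1 - cos] equals [1 - cos (n theta)], hence is bounded independently of
   [n]. *)
Lemma fejer_bound v M : continuous v -> periodic v L -> intL v = 0 ->
  (forall k b, (0 < k)%N ->
    `|intL (fun x => v x * cos (k%:R * omega L * x + b))| <= M / k%:R ^+ 2) ->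
  forall c, c \in `[0, L] -> `|v c| <= 4 * M / L.
Proof.
move=> cv pv mean0 vM c cI; rewrite leNgt; apply/negP => vc.
(* Half of the excess over the bound. One half absorbs the modulus of continuity; the other is shown
   to be at most [K / n] for every positive [n], which is absurd. *)
set e := (`|v c| - 4 * M / L) / 2.
have e0 : 0 < e by rewrite divr_gt0// subr_gt0.
have [K K0 vK] := continuity_modulus cv pv cI e0.
have bound n : (0 < n)%N -> e * n%:R <= K.
  move=> n0.
  have cF := @theta_continuous _ c (@fejer_continuous R n).
  have cvF : continuous (fun x => v x * fejer n (theta c x)).
    exact: mul_continuous.
  have cR : continuous (fun x => e * fejer n (theta c x) +
      K * (1 - cos (n%:R * omega L * x + - (n%:R * omega L * c)))).
    move=> x; apply: cvgD; first by apply: cvgM; [exact: cvg_cst|exact: cF].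
    apply: cvgM; first exact: cvg_cst.
    apply: cvgB; first exact: cvg_cst.
    exact: (test_continuous (test_wave L_gt0 n _)).
  have IR : intL (fun x => e * fejer n (theta c x) +
      K * (1 - cos (n%:R * omega L * x + - (n%:R * omega L * c)))) =
      e * (n%:R * L) + K * L.
    have cW : continuous
        (fun x => cos (n%:R * omega L * x + - (n%:R * omega L * c))).
      exact: (test_continuous (test_wave L_gt0 n _)).
    have cW1 : continuous
        (fun x => 1 - cos (n%:R * omega L * x + - (n%:R * omega L * c))).
      by move=> x; apply: cvgB; [exact: cvg_cst|exact: cW].
    have c1 : continuous (fun _ : R => 1 : R) by move=> x; exact: cvg_cst.
    rewrite RintegralD//; last 2 first.
    - apply: continuous_integrableL; apply: mul_continuous => //.
      by move=> x; exact: cvg_cst.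
    - apply: continuous_integrableL; apply: mul_continuous => //.
      by move=> x; exact: cvg_cst.
    rewrite RintegralZl//; last exact: continuous_integrableL.
    rewrite RintegralZl//; last exact: continuous_integrableL.
    rewrite RintegralB//; try exact: continuous_integrableL.
    by rewrite intL_wave// intL_cst// subr0 mul1r intL_fejer.
  have vcF : intL (fun x => (v c - v x) * fejer n (theta c x)) =
      v c * (n%:R * L) - intL (fun x => v x * fejer n (theta c x)).
    rewrite -(intL_fejer n c) -RintegralZl//; last exact: continuous_integrableL.
    rewrite -RintegralB//.
    - by apply: eq_Rintegral => x _; rewrite mulrBl.
    - apply: continuous_integrableL; apply: mul_continuous => //.
      by move=> x; exact: cvg_cst.
    - exact: continuous_integrableL.
  have := @norm_intL_le R L (fun x => (v c - v x) * fejer n (theta c x)) _ _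
    (continuous_integrableL _ cR).
  rewrite IR vcF => vcle.
  have n0R : 0 < n%:R :> R by rewrite ltr0n.
  have {}vcle : `|v c * (n%:R * L) - intL (fun x => v x * fejer n (theta c x))|
      <= e * (n%:R * L) + K * L.
    apply: vcle => [|x xI].
      apply: continuous_integrableL; apply: mul_continuous => //.
      by move=> x; apply: cvgB; [exact: cvg_cst|exact: cv].
    (* Read backwards, [fejerE] turns the majorant into the modulus of continuity times the
       kernel. *)
    rewrite normrM (ger0_norm (fejer_ge0 _ _)) -thetaE -fejerE mulrA -mulrDl.
    by apply: ler_wpM2r; [exact: fejer_ge0|exact: vK].
  have := intL_fejer_le cv mean0 vM n c; move: vcle.
  set I := intL (fun x => v x * fejer n (theta c x)) => vcle IM.
  have : `|v c| * (n%:R * L) <= 4 * M * n%:R + (e * (n%:R * L) + K * L).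
    have <- : `|v c * (n%:R * L)| = `|v c| * (n%:R * L).
      by rewrite normrM [X in _ * X]ger0_norm// mulr_ge0// ltW.
    rewrite -[X in `|X|](subrK I) addrC.
    exact: le_trans (ler_normD _ _) (lerD IM vcle).
  have -> : `|v c| = 2 * e + 4 * M / L by rewrite /e; field; rewrite gt_eqF.
  have -> : (2 * e + 4 * M / L) * (n%:R * L) =
      2 * e * n%:R * L + 4 * M * n%:R by field; rewrite gt_eqF.
  move=> h; rewrite -(ler_pM2r L_gt0); lra.
have := bound _ (ltn0Sn (Num.bound (K / e))).
apply/negP; rewrite -ltNge mulrC -ltr_pdivrMr// -natr1.
by rewrite (lt_trans (archi_boundP _))// ?ltrDl// divr_ge0// ltW.
Qed.

End FejerBound.

(** * Functions orthogonal to all test functions *)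

Section StepPolynomials.
Context {R : realType}.
Implicit Types (x h : R) (m n : nat).

Lemma onemX_ge x m : 0 <= x <= 1 -> 1 - m%:R * x <= (1 - x) ^+ m.
Proof.
move=> /andP[x0 x1]; elim: m => [|m IH]; first by rewrite mul0r subr0 expr0.
have m0 : 0 <= m%:R :> R by [].
have xm := mulr_ge0 m0 (sqr_ge0 x).
rewrite exprSr; apply: (@le_trans _ _ ((1 - m%:R * x) * (1 - x))).
  rewrite -[m.+1%:R]natr1; nra.
by apply: ler_wpM2r; rewrite ?subr_ge0.
Qed.

(** The product does not increase with [m], since [(1 - x) * (1 + (m + 1) * x) <= 1 + m * x]. *)
Lemma onemX_le x m : 0 <= x <= 1 -> (1 - x) ^+ m * (1 + m%:R * x) <= 1.
Proof.
move=> /andP[x0 x1]; elim: m => [|m IH]; first by rewrite mul0r addr0 mulr1.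
apply: le_trans IH; rewrite exprSr -mulrA; apply: ler_wpM2l.
  by rewrite exprn_ge0// subr_ge0.
have m0 : 0 <= m%:R :> R by [].
have xm := mulr_ge0 m0 (sqr_ge0 x).
rewrite -[m.+1%:R]natr1; nra.
Qed.

(* By Bernoulli's inequality [(1 - q^n)^(2^n)] tends to 1 for [2 q < 1] and to 0
   for [2 q > 1]; the threshold [q = 1/2] is moved to [h = 0]. *)
Definition step n h := (1 - ((1 - h) / 2) ^+ n) ^+ (2 ^ n).

Lemma step_itv n h : -1 <= h <= 1 -> 0 <= step n h <= 1.
Proof.
move=> /andP[h1 h2]; have q0 : 0 <= (1 - h) / 2 by lra.
have q1 : (1 - h) / 2 <= 1 by lra.
have qn0 : 0 <= ((1 - h) / 2) ^+ n by exact: exprn_ge0.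
have qn1 : ((1 - h) / 2) ^+ n <= 1 by exact: exprn_ile1.
by rewrite /step exprn_ge0 ?exprn_ile1// ?subr_ge0// gerBl.
Qed.

(** The factor 2^n cancels the denominator: Bernoulli bounds the step below by [1 - (1 - h) ^+ n],
    and [1 - h] lies in [0, 1[. *)
Lemma step_cvg1 h : 0 < h <= 1 -> step n h @[n --> \oo] --> (1 : R).
Proof.
move=> /andP[h0 h1].
have q0 : 0 <= 1 - h by lra.
apply: (@squeeze_cvgr _ _ _ _ (fun n => 1 - (1 - h) ^+ n) (fun=> 1)).
- apply: nearW => n; have /andP[_ ->] : 0 <= step n h <= 1.
    by apply: step_itv; lra.
  rewrite andbT; apply: le_trans (onemX_ge _ _); last first.
    by rewrite exprn_ge0 ?exprn_ile1//; lra.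
  by rewrite natrX -exprMn mulrCA mulfV ?mulr1// pnatr_eq0.
- rewrite -[X in _ --> X](subr0 (1:R)); apply: cvgB; first exact: cvg_cst.
  by apply: cvg_expr; rewrite ger0_norm; lra.
- exact: cvg_cst.
Qed.

(** Now [1 - h] exceeds 1, and [onemX_le] bounds the step above by the inverse of [(1 - h) ^+ n]. *)
Lemma step_cvg0 h : -1 <= h < 0 -> step n h @[n --> \oo] --> (0 : R).
Proof.
move=> /andP[h1 h0].
have q0 : 0 < 1 - h by lra.
apply: (@squeeze_cvgr _ _ _ _ (fun=> 0) (fun n => (1 - h)^-1 ^+ n)).
- apply: nearW => n; have /andP[s0 _] : 0 <= step n h <= 1.
    by apply: step_itv; lra.
  rewrite s0/=.
  have := @onemX_le (((1 - h) / 2) ^+ n) (2 ^ n).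
  rewrite -/(step n h) natrX -exprMn mulrCA mulfV ?mulr1 ?pnatr_eq0// => le1.
  have r0 : 0 <= (1 - h) ^+ n by rewrite exprn_ge0// ltW.
  have r1 : 0 < (1 - h) ^+ n by rewrite exprn_gt0.
  rewrite exprVn -(ler_pM2r r1) mulVf ?gt_eqF//.
  apply: le_trans (le1 _); last first.
    by rewrite exprn_ge0 ?exprn_ile1//; lra.
  by rewrite ler_wpM2l// lerDr.
- exact: cvg_cst.
- by apply: cvg_expr; rewrite ger0_norm ?invr_ge0 ?(ltW q0)// invf_lt1//; lra.
Qed.

End StepPolynomials.

(** * The du Bois-Reymond lemma on the circle *)

Section DuBoisReymond.
Context {R : realType} (L : R).
Hypothesis L_gt0 : 0 < L.
Local Notation mu := (@lebesgue_measure R).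
Local Notation intL f := (\int[mu]_(x in `[0, L]) f x).
Local Notation integrableL f := (mu.-integrable `[0, L] (EFin \o f)).
Implicit Types (f g : R -> R) (a t x : R).

Lemma ae_neq a : {ae mu, forall x, x != a}.
Proof.
exists [set a]; split => //; first exact: lebesgue_measure_set1.
by move=> x /= /negP; rewrite negbK => /eqP.
Qed.

(* The half-angle factors in [cutoffE] have period 2 L only; expanding their
   product shows that it is a test function. *)
Definition cutoff t x :=
  2^-1 * (cos (1%:R * omega L * x + - (omega L * t / 2)) - cos (omega L * t / 2)).

Lemma cutoffE t x :
  cutoff t x = sin (omega L * x / 2) * sin (omega L * (t - x) / 2).
Proof.
rewrite /cutoff.
have -> : 1%:R * omega L * x + - (omega L * t / 2) =
  omega L * x / 2 - omega L * (t - x) / 2 by field.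
have -> : omega L * t / 2 = omega L * x / 2 + omega L * (t - x) / 2 by field.
by rewrite cosB cosD; field.
Qed.

Lemma cutoff_itv t x : -1 <= cutoff t x <= 1.
Proof.
rewrite /cutoff.
have := cos_le1 (1%:R * omega L * x + - (omega L * t / 2)).
have := cos_geN1 (1%:R * omega L * x + - (omega L * t / 2)).
have := cos_le1 (omega L * t / 2); have := cos_geN1 (omega L * t / 2).
by move: (cos _) (cos _) => p q *; lra.
Qed.

Lemma sin_half_gt0 x : 0 < x < L -> 0 < sin (omega L * x / 2).
Proof.
move=> /andP[x0 xL]; apply: sin_gt0_pi.
have w0 := omega_gt0 L_gt0.
apply/andP; split; first by rewrite divr_gt0// mulr_gt0.
by rewrite ltr_pdivrMr// [pi * 2]mulrC -(omegaL L_gt0) ltr_pM2l.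
Qed.

Lemma cutoff_gt0 t x : t < L -> 0 < x < t -> 0 < cutoff t x.
Proof.
move=> tL /andP[x0 xt]; rewrite cutoffE mulr_gt0// sin_half_gt0//.
  by rewrite x0 (lt_trans xt).
by apply/andP; split; lra.
Qed.

Lemma cutoff_lt0 t x : 0 < t -> t < x < L -> cutoff t x < 0.
Proof.
move=> t0 /andP[tx xL]; rewrite cutoffE pmulr_rlt0; last first.
  by rewrite sin_half_gt0// xL (lt_trans t0).
have -> : omega L * (t - x) / 2 = - (omega L * (x - t) / 2) by field.
by rewrite sinN oppr_lt0 sin_half_gt0//; apply/andP; split; lra.
Qed.

Lemma test_cutoff t : test_function L (cutoff t).
Proof.
have -> : cutoff t = (cst 2^-1) \*
    ((fun x => cos (1%:R * omega L * x + - (omega L * t / 2))) \+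
     cst (- cos (omega L * t / 2))) by [].
by apply: testM; [exact: test_cst|apply: testD; [exact: test_wave|exact: test_cst]].
Qed.

Lemma test_step n t : test_function L (fun x => step n (cutoff t x)).
Proof.
pose p := (fun x => (1 - cutoff t x) / 2).
have tp : test_function L p.
  have -> : p = ((cst 1) \+ (cst (-1) \* cutoff t)) \* cst 2^-1.
    by apply/funext => x; rewrite /p /= mulN1r.
  apply: testM; last exact: test_cst.
  apply: testD; first exact: test_cst.
  by apply: testM; [exact: test_cst|exact: test_cutoff].
have -> : (fun x => step n (cutoff t x)) =
    (fun x => (cst 1 \+ (cst (-1) \* (fun x => p x ^+ n))) x ^+ (2 ^ n)).
  by apply/funext => x; rewrite /step /= mulN1r.
apply: testX; apply: testD; first exact: test_cst.
by apply: testM; [exact: test_cst|exact: testX].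
Qed.

Section Annihilated.
Variable f : R -> R.
Hypothesis mf : measurable_fun setT f.
Hypothesis fi : integrableL f.
Hypothesis f0 : forall phi, test_function L phi ->
  intL (fun x => f x * phi x) = 0.

(** The test functions [step n (cutoff t x)] have values in [0, 1] and tend almost everywhere on
    [0, L] to the indicator of [0, t]; dominated convergence applies with majorant [|f|]. *)
Lemma intL_initial0 t : 0 < t < L -> \int[mu]_(x in `[0, t]) f x = 0.
Proof.
move=> /andP[t0 tL].
have -> : `[0, t]%classic = `[0, L]%classic `&` `[0, t]%classic :> set R.
  rewrite setIidr// => x /=; rewrite !in_itv/= => /andP[-> xt].
  by rewrite (le_trans xt)// ltW.
rewrite Rintegral_mkcondr.
pose F n x : \bar R := (f x * step n (cutoff t x))%:E.
have [] := @dominated_convergence _ _ R mu `[0, L]%classic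
  (measurable_itv _) F (EFin \o (f \_ `[0, t])) (abse \o (EFin \o f)).
- move=> n; apply/measurable_EFinP; apply: measurable_funM.
    exact: measurable_funTS.
  apply: measurable_funTS; apply: continuous_measurable_fun.
  exact: (test_continuous (test_step n t)).
- apply/measurable_EFinP; apply: measurable_funTS.
  by apply/(measurable_restrictT _ _).1 => //; exact: measurable_funTS.
(* At these three points the cutoff vanishes, which is the threshold of the step; they are discarded
   as a null set. *)
- have := ae_neq 0; have := ae_neq t; have := ae_neq L.
  apply: filterS3; first exact: (ae_filter_ringOfSetsType mu).
  move=> x xL xt x0; rewrite /= in_itv/= => /andP[x0' xL'].
  have {x0 x0'}x0 : 0 < x by rewrite lt_neqAle eq_sym x0.
  have {xL xL'}xL : x < L by rewrite lt_neqAle xL.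
  apply: cvg_EFin; first by apply: nearW => n.
  have /andP[c1 c2] := cutoff_itv t x.
  rewrite patchE; have [xt'|tx|xtE] := ltgtP x t.
  + rewrite mem_set; last by rewrite /= in_itv/= !ltW.
    rewrite -[X in _ --> X]mulr1; apply: cvgM; first exact: cvg_cst.
    by apply: step_cvg1; rewrite c2 cutoff_gt0// x0.
  + rewrite memNset; last by rewrite /= in_itv/= (ltW x0)/= leNgt tx.
    rewrite -[X in _ --> X](mulr0 (f x)); apply: cvgM; first exact: cvg_cst.
    by apply: step_cvg0; rewrite c1 cutoff_lt0// tx.
  + by rewrite xtE eqxx in xt.
- exact: integrable_abse.
- apply/aeW => x n _; rewrite /F/= lee_fin normrM ler_piMr//.
  by have /andP[s0 s1] := step_itv n (cutoff_itv t x); rewrite ger0_norm.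
move=> _ _; rewrite /Rintegral.
(* [f0] concerns the real part of the extended integral, so finiteness is needed to conclude that
   the integral itself is 0. *)
have -> : [sequence (\int[mu]_(x in `[0%R, L]) F n x)%E]_n = cst 0%E.
  apply/funext => n /=; rewrite -[LHS]fineK.
    by congr EFin; exact: f0 (test_step n t).
  apply: integrable_fin_num => //.
  by apply: integrableL_mulc => //; exact: (test_continuous (test_step n t)).
by move/(cvg_unique _ (cvg_cst _)) => <-.
Qed.

(** By Lebesgue's differentiation theorem [f] is almost everywhere the derivative of its primitive,
    which is 0 on ]0, L[. *)
Lemma annihilated_ae0 : vanishes_ae L f.
Proof.
have mI : measurable (`[0, L]%classic : set R) by exact: measurable_itv.
(* Integrability of [f] is given on [0, L] only, while the differentiation theorem asks for local
   integrability on the line. *)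
pose fL := f \_ `[0, L].
have fLi : mu.-integrable setT (EFin \o fL).
  by have := (integrable_mkcond (mu := mu) (EFin \o f) (measurable_itv `[0, L])).1 fi; rewrite restrict_EFin.
have iy y : mu.-integrable `[0, y] (EFin \o fL).
  by apply: integrableS fLi => //; exact: measurable_itv.
have := @FTC1 R fL (BLeft 0) iy (integrable_locally mI fi).
have := ae_neq L; have := ae_neq 0; rewrite /vanishes_ae.
apply: filterS3; first exact: (ae_filter_ringOfSetsType mu).
move=> x x0 xL FTC; rewrite in_itv/= => /andP[x0' xL'].
have {x0 x0'}x0 : 0 < x by rewrite lt_neqAle eq_sym x0.
have {xL xL'}xL : x < L by rewrite lt_neqAle xL.
have [|_] := FTC; first by [].
rewrite /fL patchE mem_set; last by rewrite /= in_itv/= !ltW.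
move=> <-; rewrite derive1E.
rewrite (@near_eq_derive _ _ _ _ (cst 0)) ?derive_cst//.
have : \forall y \near x, y \in `]0, L[.
  by apply: near_in_itvoo; rewrite in_itv/= x0.
apply: filterS => y; rewrite in_itv/= => /andP[y0 yL].
transitivity (\int[mu]_(x in `[0, y]) f x); last by rewrite intL_initial0// y0.
apply: eq_Rintegral => z; rewrite inE/= in_itv/= => /andP[z0 zy].
by rewrite patchE mem_set//= in_itv/= z0 (le_trans zy)// ltW.
Qed.

End Annihilated.
End DuBoisReymond.

(** * Isolation of the zero solution *)

Section WeakDerivatives.
Context {R : realType} (L : R).
Hypothesis L_gt0 : 0 < L.
Local Notation mu := (@lebesgue_measure R).
Local Notation intL f := (\int[mu]_(x in `[0, L]) f x).
Local Notation integrableL f := (mu.-integrable `[0, L] (EFin \o f)).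
Implicit Types (f u v w phi : R -> R) (k : nat) (x t : R).

(** On an interval of finite length, [|f| <= f ^+ 2 + 1] suffices. *)
Lemma L2per_integrable f : L2per L f -> integrableL f.
Proof.
move=> [_ mf f2i].
have gi : integrableL (fun x => f x ^+ 2 + 1).
  have -> : EFin \o (fun x => f x ^+ 2 + 1) =
      ((fun x => (f x ^+ 2)%R%:E) \+ (EFin \o (cst 1%R : R -> R)))%E.
    by apply/funext => x; rewrite /= EFinD.
  apply: integrableD => //; apply: continuous_integrableL.
  by move=> x; exact: cvg_cst.
apply: le_integrable gi => //.
  by apply/measurable_EFinP; exact: measurable_funTS.
move=> x _; rewrite /= lee_fin [leRHS]ger0_norm ?addr_ge0 ?sqr_ge0//.
rewrite ler_norml; apply/andP; split; nra.
Qed.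

Lemma L2per0 : L2per L (cst 0).
Proof.
split=> //.
have -> : (fun x : R => (cst (0:R) x ^+ 2)%:E) = cst 0%E.
  by apply/funext => x; rewrite /= expr0n.
exact: integrable0.
Qed.

Lemma L2norm_sqr f : L2norm L f ^+ 2 = intL (fun x => f x ^+ 2).
Proof.
by rewrite sqr_sqrtr// Rintegral_ge0// => x _; exact: sqr_ge0.
Qed.

(** The pointwise bound [|f| <= t + f ^+ 2 / t] takes the place of the Cauchy-Schwarz inequality, at
    the price of the factor [L + 1]. *)
Lemma intL_norm_le f t : L2per L f -> 0 < t -> L2norm L f <= t ->
  intL (fun x => `|f x|) <= t * (L + 1).
Proof.
move=> L2f t0 ft.
have fi := L2per_integrable L2f.
have [_ _ f2i] := L2f.
have ti : integrableL (fun=> t).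
  by apply: continuous_integrableL => x; exact: cvg_cst.
have f2ti : integrableL (fun x => t^-1 * f x ^+ 2).
  exact: (@integrableZl _ _ _ mu _ (measurable_itv _) t^-1 _ f2i).
have le1 : intL (fun x => `|f x|) <= intL (fun x => t + t^-1 * f x ^+ 2).
  apply: le_Rintegral => //.
  - have -> : EFin \o (fun x => `|f x|) = (fun x => `|(EFin \o f) x|%E) by [].
    exact: integrable_abse.
  - exact: (@integrableD _ _ _ mu _ (measurable_itv _) _ _ ti f2ti).
  move=> x _; rewrite -(ler_pM2l t0) mulrDr mulrA mulfV ?gt_eqF// mul1r.
  have -> : f x ^+ 2 = `|f x| ^+ 2 by rewrite real_normK ?num_real.
  by have := normr_ge0 (f x); nra.
apply: (le_trans le1); rewrite RintegralD// RintegralZl// intL_cst//.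
rewrite -L2norm_sqr mulrDr mulr1 lerD2l -(ler_pM2l t0) mulrA mulfV ?gt_eqF// mul1r.
by rewrite -expr2 lerXn2r ?nnegrE ?sqrtr_ge0// ltW.
Qed.

Lemma L2norm_le_Hnorm k j u : (j <= k)%N -> L2norm L (wD L j u) <= Hnorm L k u.
Proof.
move=> jk; rewrite -[leLHS]ger0_norm ?sqrtr_ge0// -sqrtr_sqr ler_wsqrtr//.
rewrite (bigD1 (Ordinal (jk : (j < k.+1)%N)))//= lerDl.
by apply: sumr_ge0 => i _; exact: sqr_ge0.
Qed.

Lemma wDP k u : (exists v, weak_derivative L k u v) ->
  weak_derivative L k u (wD L k u).
Proof. by move=> [v wv]; exact: (xgetPex (cst 0) (ex_intro _ v wv)). Qed.

Lemma wDN k u : ~ (exists v, weak_derivative L k u v) -> wD L k u = cst 0.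
Proof. by move=> nex; apply: xgetPN => v wv; apply: nex; exists v. Qed.

Lemma wD_L2per k u : L2per L (wD L k u).
Proof.
have [ex|nex] := pselect (exists v, weak_derivative L k u v).
  by case: (wDP ex).
by rewrite (wDN nex); exact: L2per0.
Qed.

Lemma weak_derivative0 k : weak_derivative L k (cst 0) (cst 0).
Proof.
split=> [|phi _]; first exact: L2per0.
have I0 f : intL (fun x => cst 0 x * f x) = 0.
  by under eq_Rintegral do rewrite mul0r; rewrite intL_cst// mul0r.
by rewrite !I0 mulr0.
Qed.

(** [wD] chooses some weak derivative of 0, known only through its integrals against test functions;
    these all vanish. *)
Lemma wD0_ae0 k : vanishes_ae L (wD L k (cst 0)).
Proof.
have [L2w wE] := wDP (ex_intro _ _ (weak_derivative0 k)).
have [_ mw _] := L2w.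
apply: (annihilated_ae0 L_gt0 mw (L2per_integrable L2w)) => phi tphi.
have /esym/eqP := wE _ tphi.
have -> : intL (fun x => cst 0 x * derive1n k phi x) = 0.
  by under eq_Rintegral do rewrite mul0r; rewrite intL_cst// mul0r.
by rewrite mulf_eq0 signr_eq0/= => /eqP.
Qed.

Lemma vanishes_ae_intL f phi : measurable_fun setT f -> continuous phi ->
  vanishes_ae L f -> intL (fun x => f x * phi x) = 0.
Proof.
move=> mf cphi f0; rewrite /Rintegral.
rewrite (@ae_eq_integral _ _ _ mu _ (cst 0%E)) ?integral0//.
- apply/measurable_EFinP; apply: measurable_funM; first exact: measurable_funTS.
  by apply: measurable_funTS; exact: continuous_measurable_fun.
- apply: filterS f0; first exact: (ae_filter_ringOfSetsType mu).
  by move=> x fx xI; rewrite fx ?mul0r.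
Qed.

Lemma Hdot0 k : Hdot L k (cst 0).
Proof.
split; last by rewrite intL_cst// mul0r.
split=> [x||j _]; [exact: cvg_cst|by []|].
by exists (cst 0); exact: weak_derivative0.
Qed.

End WeakDerivatives.

Section Potential.
Context {R : realType}.

Lemma derive1_W (x : R) : derive1 W x = x ^+ 3 - x.
Proof.
rewrite derive1E; apply: derive_val; apply: is_derive_eq.
by rewrite /GRing.scale/=; field.
Qed.

End Potential.

Section Periodic.
Context {R : realType} (L : R).
Hypothesis L_gt0 : 0 < L.

Lemma periodic_eq0 (v : R -> R) : periodic v L ->
  (forall x, x \in `[0, L] -> v x = 0) -> v = cst 0.
Proof.
move=> pv v0; apply/funext => x /=.
have pvn n y : v (y + L *+ n) = v y.
  by elim: n => [|n IH]; rewrite ?mulr0n ?addr0// mulrSr addrA pv.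
pose m := Num.floor (x / L).
have mx := floor_itv (x / L).
have yI : x - L * m%:~R \in `[0, L].
  move: mx => /andP[m1 m2]; rewrite in_itv/=; apply/andP; split.
    by rewrite subr_ge0 mulrC -ler_pdivlMr.
  have -> : x - L * m%:~R <= L = (x <= (m + 1)%:~R * L).
    by rewrite lerBlDr intrD mulrDl mul1r addrC [L * _]mulrC.
  by rewrite -ler_pdivrMr// ltW.
(* [pvn] shifts by a natural number of periods, so a negative floor is handled by shifting from the
   other side. *)
move: yI; case: m {mx} => n yI.
  by rewrite -(v0 _ yI) -[RHS](pvn n) -mulr_natr subrK.
rewrite -(v0 _ yI) NegzE mulrNz mulrN opprK.
by rewrite -[LHS](pvn n.+1) -mulr_natr.
Qed.

End Periodic.

(** * Distance of the Fourier modes from resonance *)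

Section SpectralGap.
Context {R : realType} (L : R).
Hypothesis L_gt0 : 0 < L.
Hypothesis L_nonresonant : forall k, (0 < k)%N -> L <> 2 * k%:R * pi.

Lemma resonance_neq0 k : (0 < k)%N -> (k%:R * omega L) ^+ 2 - 1 != 0.
Proof.
move=> k0; apply/negP => /eqP /subr0_eq /eqP.
have kw0 : 0 <= k%:R * omega L by rewrite mulr_ge0// ltW// omega_gt0.
rewrite sqrp_eq1// => /eqP kw.
apply: (L_nonresonant k0).
by rewrite mulrAC -(omegaL L_gt0) mulrAC [_ * k%:R]mulrC kw mul1r.
Qed.

(** Finitely many small [k] contribute a minimum of positive numbers; for large [k] quadratic growth
    dominates. The cap on [c] serves [nonlinear_moment_le] when [W'(v)] has no fourth weak
    derivative. *)
Lemma spectral_gap : exists2 c, 0 < c <= omega L ^+ 2 & forall k, (0 < k)%N ->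
  c * k%:R ^+ 2 <= `|(k%:R * omega L) ^+ 2 - 1|.
Proof.
have w0 := omega_gt0 L_gt0.
have finite_gap N : exists2 c : R, 0 < c & forall k, (0 < k <= N)%N ->
    c * k%:R ^+ 2 <= `|(k%:R * omega L) ^+ 2 - 1|.
  elim: N => [|N [c c0 gap]].
    by exists 1 => // k /andP[k0]; rewrite leqNgt k0.
  pose d := `|(N.+1%:R * omega L) ^+ 2 - 1| / N.+1%:R ^+ 2.
  have d0 : 0 < d by rewrite divr_gt0// normr_gt0 resonance_neq0.
  exists (Num.min c d) => [|k /andP[k0]]; first by rewrite lt_min c0.
  rewrite leq_eqVlt => /predU1P[->|kN].
    rewrite -ler_pdivlMr; first by rewrite ge_min lexx orbT.
    by rewrite exprn_gt0.
  apply: le_trans (gap k _); last by rewrite k0.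
  by apply: ler_wpM2r; [exact: sqr_ge0|rewrite ge_min lexx].
(* For [k] beyond [N] the square p of [k * omega] is at least 2, whence [p - 1 >= p / 2]. *)
pose N := Num.bound (2 / omega L ^+ 2).
have [c c0 gap] := finite_gap N.
exists (Num.min c (omega L ^+ 2 / 2)) => [|k k0].
  rewrite lt_min c0 divr_gt0 ?exprn_gt0//= ge_min; apply/orP; right.
  by rewrite ler_pdivrMr// ler_peMr ?sqr_ge0// ler1n.
have [kN|Nk] := leqP k N.
  apply: le_trans (gap k _); last by rewrite k0.
  by apply: ler_wpM2r; [exact: sqr_ge0|rewrite ge_min lexx].
apply: (@le_trans _ _ (omega L ^+ 2 / 2 * k%:R ^+ 2)).
  by apply: ler_wpM2r; [exact: sqr_ge0|rewrite ge_min lexx orbT].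
have k2 : 2 <= omega L ^+ 2 * k%:R ^+ 2.
  rewrite mulrC -ler_pdivrMr ?exprn_gt0//.
  have : 2 / omega L ^+ 2 < N%:R by apply: archi_boundP; rewrite divr_ge0// sqr_ge0.
  move=> /ltW/le_trans; apply; rewrite -natrX ler_nat.
  by rewrite (leq_trans (ltnW Nk))// leq_pmulr.
apply: le_trans (ler_norm _).
have -> : (k%:R * omega L) ^+ 2 = omega L ^+ 2 * k%:R ^+ 2 by ring.
rewrite mulrAC; move: (_ * _) k2 => p p2; lra.
Qed.

End SpectralGap.

(** * Moments of a small solution, and the contraction *)

Section Isolation.
Context {R : realType} (L : R).
Hypothesis L_gt0 : 0 < L.
Local Notation mu := (@lebesgue_measure R).
Local Notation intL f := (\int[mu]_(x in `[0, L]) f x).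
Local Notation integrableL f := (mu.-integrable `[0, L] (EFin \o f)).
Implicit Types (u v phi : R -> R) (k : nat) (x b delta eps s : R).

(** Two quarter turns reverse the sign, so even derivatives return the same wave. The coefficient
    [c] makes the formula iterable, up to orders 4 and 6. *)
Lemma derive1n2_wave (a b c : R) :
  derive1n 2 (fun x => c * cos (a * x + b)) =
  (fun x => (- a ^+ 2 * c) * cos (a * x + b)).
Proof.
rewrite derive1nS derive1n1 !derive1_wave; apply/funext => x.
rewrite !addrA !cosDpihalf sinDpihalf; ring.
Qed.

Lemma derive1nD m n (f : R -> R) :
  derive1n (m + n) f = derive1n m (derive1n n f).
Proof. exact: iterD. Qed.

Lemma derive1n4_wave (a b : R) :
  derive1n 4 (fun x => cos (a * x + b)) = (fun x => a ^+ 4 * cos (a * x + b)).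
Proof.
have -> : (fun x => cos (a * x + b)) = (fun x => 1 * cos (a * x + b)).
  by apply/funext => x; rewrite mul1r.
rewrite (derive1nD 2 2) !derive1n2_wave; apply/funext => x; ring.
Qed.

Lemma derive1n6_wave (a b : R) :
  derive1n 6 (fun x => cos (a * x + b)) = (fun x => - a ^+ 6 * cos (a * x + b)).
Proof.
rewrite (derive1nD 2 4) derive1n4_wave derive1n2_wave.
by apply/funext => x; ring.
Qed.

Section WaveMoments.
Variables (v : R -> R) (delta eps s : R).
Hypothesis sol : solution L delta v.
Hypothesis eps_gt0 : 0 < eps.
Hypothesis v_small : Hnorm L 6 v < eps.
Hypothesis vs : forall x, x \in `[0, L] -> `|v x| <= s.

Let cv : continuous v. Proof. by case: sol => -[[]]. Qed.

Let wv j : (j <= 6)%N -> weak_derivative L j v (wD L j v).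
Proof. by move=> j6; case: sol => -[[_ _ ex] _] _; exact: wDP (ex _ j6). Qed.

Let s_ge0 : 0 <= s.
Proof.
apply: le_trans (vs (_ : 0 \in _)); first exact: normr_ge0.
by rewrite in_itv/= lexx ltW.
Qed.

Let wD_intL_le j : (j <= 6)%N ->
  intL (fun x => `|wD L j v x|) <= eps * (L + 1).
Proof.
move=> j6; apply: intL_norm_le => //; first exact: wD_L2per.
exact: le_trans (L2norm_le_Hnorm _ _ j6) (ltW v_small).
Qed.

Let integrable_norm f : integrableL f -> integrableL (fun x => `|f x|).
Proof.
move=> fi; have -> : EFin \o (fun x => `|f x|) = (fun x => `|(EFin \o f) x|%E).
  by [].
exact: integrable_abse.
Qed.

(** Two derivatives pass from the wave to [v], and the second weak derivative is small in L^1 by the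
    Sobolev bound. This gives the first, crude decay. *)
Lemma wave_moment_le k b : (0 < k)%N ->
  `|intL (fun x => v x * cos (k%:R * omega L * x + b))| <=
  (eps * (L + 1) / omega L ^+ 2) / k%:R ^+ 2.
Proof.
move=> k0; set a := k%:R * omega L.
have a0 : 0 < a by rewrite mulr_gt0 ?ltr0n ?omega_gt0.
have tw := test_wave L_gt0 k b; have cw := test_continuous tw.
have [L2w /(_ _ tw)] := wv (isT : (2 <= 6)%N).
have -> : derive1n 2 (fun x => cos (k%:R * omega L * x + b)) =
    (fun x => - a ^+ 2 * cos (a * x + b)).
  have := @derive1n2_wave a b 1; rewrite mulr1 => <-.
  by congr (derive1n 2); apply/funext => x; rewrite mul1r.
have wi := L2per_integrable L2w.
have -> : intL (fun x => v x * (- a ^+ 2 * cos (a * x + b))) =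
    - a ^+ 2 * intL (fun x => v x * cos (a * x + b)).
  rewrite -RintegralZl//; last first.
    by apply: continuous_integrableL; exact: mul_continuous.
  by apply: eq_Rintegral => x _; ring.
rewrite sqrrN expr1n mul1r => E.
have -> : eps * (L + 1) / omega L ^+ 2 / k%:R ^+ 2 = eps * (L + 1) / a ^+ 2.
  by rewrite /a [X in _ = _ / X]exprMn [in RHS]invfM [RHS]mulrA [LHS]mulrAC.
rewrite ler_pdivlMr ?exprn_gt0//.
have -> : `|intL (fun x => v x * cos (a * x + b))| * a ^+ 2 =
    `|- a ^+ 2 * intL (fun x => v x * cos (a * x + b))|.
  by rewrite normrM normrN [`|a ^+ 2|]ger0_norm ?sqr_ge0// mulrC.
rewrite E; apply: le_trans (wD_intL_le (isT : (2 <= 6)%N)).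
apply: norm_intL_le; [exact: integrableL_mulc|exact: integrable_norm|].
by move=> x _; rewrite normrM ler_piMr// ler_norml cos_le1 cos_geN1.
Qed.

Lemma small_solution_le x : x \in `[0, L] ->
  `|v x| <= 4 * (eps * (L + 1) / omega L ^+ 2) / L.
Proof.
case: sol => -[[_ pv _] mean0] _.
by apply: fejer_bound => // k b; exact: wave_moment_le.
Qed.

(** One factor is bounded by [s], the other in L^1 by a multiple of [eps]; keeping the factor [s] is
    what allows absorption later. *)
Lemma advection_moment_le k b :
  `|intL (fun x => (v x * wD L 1 v x) * cos (k%:R * omega L * x + b))| <=
  s * (eps * (L + 1)).
Proof.
have [L2w _] := wv (isT : (1 <= 6)%N); have wi := L2per_integrable L2w.
have cw := test_continuous (test_wave L_gt0 k b).
apply: (@le_trans _ _ (intL (fun x => s * `|wD L 1 v x|))).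
  apply: norm_intL_le.
  - have -> : EFin \o (fun x => v x * wD L 1 v x *
        cos (k%:R * omega L * x + b)) =
        EFin \o ((wD L 1 v \* v) \* (fun x => cos (k%:R * omega L * x + b))).
      by apply/funext => x /=; rewrite [v x * _]mulrC.
    by do 2! apply: integrableL_mulc => //.
  - exact: (@integrableZl _ _ _ mu _ (measurable_itv _) s _ (integrable_norm wi)).
  move=> x xI; rewrite !normrM -[leRHS]mulr1 ler_pM ?mulr_ge0//.
    by rewrite ler_wpM2r// vs.
  by rewrite ler_norml cos_le1 cos_geN1.
rewrite RintegralZl//; last exact: integrable_norm.
by rewrite ler_wpM2l// wD_intL_le.
Qed.

Lemma cube_continuous : continuous (fun x => v x ^+ 3).
Proof.
rewrite (_ : (fun x => v x ^+ 3) = v \* (v \* v)).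
  by do 2! apply: mul_continuous => //.
by apply/funext => x /=; ring.
Qed.

Lemma cubic_moment_le k b :
  `|intL (fun x => v x ^+ 3 * cos (k%:R * omega L * x + b))| <= s ^+ 3 * L.
Proof.
have cw := test_continuous (test_wave L_gt0 k b).
rewrite -(intL_cst L_gt0); apply: norm_intL_le.
- apply: continuous_integrableL; apply: mul_continuous => //.
  exact: cube_continuous.
- by apply: continuous_integrableL => x; exact: cvg_cst.
move=> x xI; rewrite normrM normrX -[leRHS]mulr1 ler_pM ?exprn_ge0//.
  by rewrite lerXn2r ?nnegrE// vs.
by rewrite ler_norml cos_le1 cos_geN1.
Qed.

(** No derivative is moved onto the wave yet: for [W'(v)] this depends on the existence of a fourth
    weak derivative, decided in [nonlinear_moment_le]. *)
Lemma tested_equation k b :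
  let phi := fun x => cos (k%:R * omega L * x + b) in
  delta * intL (fun x => (v x * wD L 1 v x) * phi x) +
  intL (fun x => wD L 6 v x * phi x) =
  intL (fun x => wD L 4 (fun y => derive1 W (v y)) x * phi x).
Proof.
move=> phi; have cw := test_continuous (test_wave L_gt0 k b).
have [L2w1 _] := wv (isT : (1 <= 6)%N); have wi1 := L2per_integrable L2w1.
have [L2w6 _] := wv (isT : (6 <= 6)%N); have wi6 := L2per_integrable L2w6.
set w := fun y => derive1 W (v y).
have L2w4 := wD_L2per L 4 w; have wi4 := L2per_integrable L2w4.
have i1 : integrableL (fun x => v x * wD L 1 v x * phi x).
  have -> : EFin \o (fun x => v x * wD L 1 v x * phi x) =
      EFin \o ((wD L 1 v \* v) \* phi).
    by apply/funext => x /=; rewrite [v x * _]mulrC.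
  by do 2! apply: integrableL_mulc => //.
have i1d : integrableL (fun x => delta * (v x * wD L 1 v x * phi x)).
  exact: (@integrableZl _ _ _ mu _ (measurable_itv _) delta _ i1).
have i6 : integrableL (fun x => wD L 6 v x * phi x) by exact: integrableL_mulc.
have i4 : integrableL (fun x => wD L 4 w x * phi x) by exact: integrableL_mulc.
have i16 : integrableL
    (fun x => delta * (v x * wD L 1 v x * phi x) + wD L 6 v x * phi x).
  exact: (@integrableD _ _ _ mu _ (measurable_itv _) _ _ i1d i6).
apply/eqP; rewrite -subr_eq0 -RintegralZl// -RintegralD// -RintegralB//.
apply/eqP; transitivity (intL (fun x =>
    (delta * (v x * wD L 1 v x) + wD L 6 v x - wD L 4 w x) * phi x)).
  by apply: eq_Rintegral => x _; ring.
apply: vanishes_ae_intL => //; last by case: sol.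
case: L2w1 => _ m1 _; case: L2w6 => _ m6 _; case: L2w4 => _ m4 _.
apply: measurable_funB => //; apply: measurable_funD => //.
apply: measurable_funM => //; apply: measurable_funM => //.
exact: continuous_measurable_fun.
Qed.

Variable c : R.
Hypothesis c_itv : 0 < c <= omega L ^+ 2.
Hypothesis c_gap : forall k, (0 < k)%N ->
  c * k%:R ^+ 2 <= `|(k%:R * omega L) ^+ 2 - 1|.

(* If [W'(v)] had no fourth weak derivative, [wD] would be 0 and the cubic and
   the unstable linear terms would drop out; that case obeys the same bound, so
   the regularity of [W'(v)] need not be established. *)
Lemma nonlinear_moment_le k b : (0 < k)%N ->
  `|intL (fun x => v x * cos (k%:R * omega L * x + b))| <=
  s * ((`|delta| * (eps * (L + 1)) / omega L ^+ 4 + s ^+ 2 * L) / c) / k%:R ^+ 2.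
Proof.
move=> k0; set a := k%:R * omega L; have w0 := omega_gt0 L_gt0.
have kR : 1 <= k%:R :> R by rewrite ler1n.
have a0 : 0 < a by rewrite mulr_gt0 ?ltr0n.
have [c0 cw2] := andP c_itv.
have tw := test_wave L_gt0 k b; have cw := test_continuous tw.
set phi := fun x => cos (a * x + b).
set A := intL (fun x => v x * phi x).
have := tested_equation k b; rewrite /= -/a -/phi.
have -> : intL (fun x => wD L 6 v x * phi x) = - a ^+ 6 * A.
  have [_ /(_ _ tw)] := wv (isT : (6 <= 6)%N).
  rewrite derive1n6_wave -signr_odd expr0 mul1r => <-.
  rewrite -RintegralZl//; last first.
    by apply: continuous_integrableL; exact: mul_continuous.
  by apply: eq_Rintegral => x _; rewrite /= -/a /phi; ring.
set I1 := intL (fun x => (v x * wD L 1 v x) * phi x).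
set I4 := intL (fun x => wD L 4 (fun y => derive1 W (v y)) x * phi x) => eq4.
have I1le : `|I1| <= s * (eps * (L + 1)) by exact: advection_moment_le.
set I3 := intL (fun x => v x ^+ 3 * phi x).
have I3le : `|I3| <= s ^+ 3 * L by exact: cubic_moment_le.
have key : `|A| * (c * k%:R ^+ 2) * a ^+ 4 <= `|delta| * `|I1| + a ^+ 4 * `|I3|.
  have [ex|nex] := pselect (exists w,
      weak_derivative L 4 (fun y => derive1 W (v y)) w).
    have I4E : I4 = a ^+ 4 * (I3 - A).
      have [_ /(_ _ tw)] := wDP ex.
      rewrite derive1n4_wave -signr_odd expr0 mul1r -/I4 => <-.
      have ci3 : continuous (fun x => v x ^+ 3 * phi x).
        by apply: mul_continuous => //; exact: cube_continuous.
      have ci1 : continuous (fun x => v x * phi x) by exact: mul_continuous.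
      rewrite -RintegralB//; try exact: continuous_integrableL.
      rewrite -RintegralZl//; last first.
        apply: continuous_integrableL => x.
        by apply: cvgB; [exact: ci3|exact: ci1].
      by apply: eq_Rintegral => x _; rewrite derive1_W -/a /phi; ring.
    (* The symbol combines [a ^+ 6] from the sixth derivative with [a ^+ 4] from the linear part
       [- v] of [W'(v)]. *)
    have E : a ^+ 4 * (a ^+ 2 - 1) * A = delta * I1 - a ^+ 4 * I3.
      by move: eq4; rewrite I4E => eq4; lra.
    apply: (@le_trans _ _ `|a ^+ 4 * (a ^+ 2 - 1) * A|).
      rewrite normrM [`|a ^+ 4 * _|]normrM [`|a ^+ 4|]ger0_norm ?exprn_ge0 ?(ltW a0)//.
      have -> : a ^+ 4 * `|a ^+ 2 - 1| * `|A| = `|A| * `|a ^+ 2 - 1| * a ^+ 4.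
        by ring.
      rewrite ler_wpM2r ?exprn_ge0 ?(ltW a0)// ler_wpM2l//.
      exact: c_gap.
    rewrite E; apply: (le_trans (ler_normB _ _)).
    by rewrite normrM [`|a ^+ 4 * _|]normrM [`|a ^+ 4|]ger0_norm// exprn_ge0// ltW.
  have I40 : I4 = 0.
    rewrite /I4 (wDN nex).
    by under eq_Rintegral do rewrite mul0r; rewrite intL_cst// mul0r.
  (* The symbol is now [a ^+ 6] alone, and [c <= omega L ^+ 2] gives [c * k ^+ 2 <= a ^+ 2] in place
     of the gap. *)
  have E : a ^+ 6 * A = delta * I1 by move: eq4; rewrite I40 => eq4; lra.
  apply: (@le_trans _ _ `|a ^+ 6 * A|).
    rewrite normrM [`|a ^+ 6|]ger0_norm ?exprn_ge0 ?(ltW a0)//.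
    rewrite (_ : a ^+ 6 * `|A| = `|A| * a ^+ 2 * a ^+ 4); last by ring.
    rewrite ler_wpM2r ?exprn_ge0 ?(ltW a0)// ler_wpM2l//.
    by rewrite /a exprMn mulrC ler_wpM2l ?sqr_ge0.
  by rewrite E normrM lerDl mulr_ge0// exprn_ge0// ltW.
(* For the division by [a ^+ 4]: it cancels in the cubic term, while the advection term keeps its
   inverse, at most that of [omega L ^+ 4] because [k >= 1]. *)
have wa : omega L ^+ 4 <= a ^+ 4.
  by rewrite lerXn2r ?nnegrE ?(ltW w0) ?(ltW a0)// ler_peMl// ltW.
rewrite ler_pdivlMr ?exprn_gt0 ?ltr0n//.
rewrite [leRHS]mulrA ler_pdivlMr// -[leLHS]mulrA [k%:R ^+ 2 * c]mulrC.
have a40 : 0 < a ^+ 4 by rewrite exprn_gt0.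
have w40 : 0 < omega L ^+ 4 by rewrite exprn_gt0.
rewrite -(ler_pM2r a40); apply: (le_trans key).
have -> : s * (`|delta| * (eps * (L + 1)) / omega L ^+ 4 + s ^+ 2 * L) * a ^+ 4 =
  `|delta| * (s * (eps * (L + 1))) * (a ^+ 4 / omega L ^+ 4) + a ^+ 4 * (s ^+ 3 * L).
  by field; rewrite gt_eqF.
apply: lerD; last by rewrite ler_wpM2l// ltW.
apply: (@le_trans _ _ (`|delta| * (s * (eps * (L + 1))))).
  by rewrite ler_wpM2l.
have Lp : 0 <= L + 1 by rewrite addr_ge0// ltW.
by rewrite ler_peMr ?ler_pdivlMr ?mul1r// !mulr_ge0// ltW.
Qed.

(** With [s] the maximum of [|v|] this reads [s <= s * K], where [K] is small together with [eps]
    and [s]. *)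
Lemma small_solution_improve x : x \in `[0, L] ->
  `|v x| <= s * (4 * (`|delta| * (eps * (L + 1)) / omega L ^+ 4 + s ^+ 2 * L) /
                 (c * L)).
Proof.
case: sol => -[[_ pv _] mean0] _ xI.
have [c0 _] := andP c_itv.
apply: (le_trans (@fejer_bound R L L_gt0 v _ cv pv mean0 _ x xI)).
  by move=> k b k0; exact: nonlinear_moment_le.
by rewrite le_eqVlt; apply/orP; left; apply/eqP; field; rewrite !gt_eqF ?omega_gt0.
Qed.

End WaveMoments.

Lemma isolated_zero delta :
  (forall k, (0 < k)%N -> L <> 2 * k%:R * pi) -> isolated_solution L delta (cst 0).
Proof.
move=> nonres; have [c cI gap] := spectral_gap L_gt0 nonres.
have [c0 _] := andP cI; have w0 := omega_gt0 L_gt0.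
have Lp : 0 < L + 1 by rewrite addr_gt0.
split.
  split; first exact: Hdot0.
  have w2 : (fun y : R => derive1 W (cst (0 : R) y)) = cst 0 :> (R -> R).
    by apply/funext => y; rewrite derive1_W /= expr0n subrr.
  have := wD0_ae0 L_gt0 6; have := wD0_ae0 L_gt0 4.
  apply: filterS2; first exact: (ae_filter_ringOfSetsType mu).
  by move=> x h4 h6 xI; rewrite w2 h4// h6//= mul0r mulr0 addr0 subr0.
(* [small_solution_le] reads [s <= eps * A]. Inserted into the factor of [small_solution_improve],
   it yields at most [eps * B], provided [eps <= 1]. *)
pose A := 4 * ((L + 1) / omega L ^+ 2) / L.
have A0 : 0 <= A.
  apply: divr_ge0 (ltW L_gt0); apply: mulr_ge0 => //.
  exact: divr_ge0 (ltW Lp) (sqr_ge0 _).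
pose B := 4 * (`|delta| * (L + 1) / omega L ^+ 4 + A ^+ 2 * L) / (c * L).
have B0 : 0 <= B.
  apply: divr_ge0 (mulr_ge0 (ltW c0) (ltW L_gt0)); apply: mulr_ge0 => //.
  apply: addr_ge0; last exact: mulr_ge0 (sqr_ge0 _) (ltW L_gt0).
  apply: divr_ge0 (exprn_ge0 _ (ltW w0)).
  exact: mulr_ge0 (normr_ge0 _) (ltW Lp).
(* Chosen to give both [eps <= 1] and [eps * B <= 1 / 2]. *)
pose eps := (2 * B + 1)^-1.
have D0 : 0 < 2 * B + 1 by lra.
have eps0 : 0 < eps by rewrite invr_gt0.
have eps1 : eps <= 1 by rewrite invf_le1//; lra.
have epsB : eps * B <= 2^-1.
  by rewrite mulrC ler_pdivrMr//; lra.
exists eps => // v sol.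
have -> : (fun x => v x - cst 0 x) = v by apply/funext => x; rewrite subr0.
move=> v_small.
have cv : continuous v by case: sol => -[[]].
have pv : periodic v L by case: sol => -[[]].
apply: (periodic_eq0 L_gt0 pv).
have cn : continuous (fun x => `|v x|) by move=> x; apply: cvg_norm; exact: cv.
have [m mI vm] := @EVT_max R (fun x => `|v x|) 0 L (ltW L_gt0)
  (continuous_subspaceT cn).
have s_le : `|v m| <= eps * A.
  apply: (le_trans (small_solution_le sol eps0 v_small mI)).
  by rewrite le_eqVlt; apply/orP; left; apply/eqP; rewrite /A; field; rewrite !gt_eqF.
have := small_solution_improve sol eps0 v_small vm cI gap mI.
set s := `|v m| in s_le vm *.
have s0 : 0 <= s by exact: normr_ge0.
set K := (X in s * X) => sK.
have K2 : K <= eps * B.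
  have -> : eps * B =
     4 * (`|delta| * (eps * (L + 1)) / omega L ^+ 4 + (eps * A ^+ 2) * L) / (c * L).
    by rewrite /B; field; rewrite !gt_eqF.
  rewrite /K ler_pM2r ?invr_gt0 ?mulr_gt0// ler_pM2l// lerD2l ler_pM2r//.
  (* [eps <= 1] lets one of the two factors [eps] be dropped, so that the cubic term also scales
     linearly in [eps]. *)
  apply: (@le_trans _ _ ((eps * A) ^+ 2)).
    by rewrite lerXn2r ?nnegrE// mulr_ge0// ltW.
  rewrite exprMn ler_wpM2r ?sqr_ge0// expr2 ler_piMl// ltW//.
have s_0 : s = 0.
  have : s * K <= s * 2^-1 by rewrite ler_wpM2l// (le_trans K2).
  lra.
move=> x xI; apply/eqP; rewrite -normr_le0.
by rewrite (le_trans (vm x xI))// s_0.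
Qed.

End Isolation.

Unset Implicit Arguments.

Theorem proposition2p24 (R : realType) (L : R) (n : nat)
    (u : 'I_n -> R -> R) (delta0 delta1 : R) (ub : 'I_n -> R -> R -> R)
    (delta : R) :
  (`]0, +oo[ `\` excE) L ->
  orbit_representatives L u ->
  0 < delta0 ->
  solution_branches L u delta0 ub ->
  0 < delta1 <= delta0 ->
  kernel_condition L delta1 ub ->
  `|delta| < delta1 ->
  isolated_solution L delta (cst 0).
Proof.
move=> [/= + LE] _ _ _ _ _ _; rewrite in_itv/= andbT => L0.
(* A resonant length [2 * k * pi] would lie in the second part of [excE]. *)
apply: isolated_zero => // k k0 Lk; apply: LE; right.
by exists k.
Qed.
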